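(* Let $M\ge1$, $R\in(-1,1)^{M+1}$, $T_n=\sqrt{1-R_n^2}$, $k\in\mathfrak{L}_M$, and $u=\min\{\mathbb{1},\tilde k\}$. Then the (finite) sum of weights of scattering sequences with transit count vector $k$ is $$\mathfrak{a}(R,k):=\sum_{\mathsf{p}\in\mathsf{S}_M:\ \kappa(\mathsf{p})=k}w(\mathsf{p})=\sum_{b\in V(k)}\binom{k}{b}\binom{\tilde k-u}{b-u}(-R)^{\tilde k-b}R^{k-b}T^{2b},$$ where $V(k)=\{b\in\mathbb{Z}^{M+1}:u\le b\le\min\{k,\tilde k\}\}$. In particular $\mathfrak{a}(R,k)=a(R,k)$, the $k$-amplitude polynomial evaluated at $R$.
   Context: Scattering sequences: $\mathsf{S}_M$ is the set of integer sequences $\mathsf{p}=(i_0,\ldots,i_L)$ with $L\ge2$, $i_0=i_L=-1$, $i_j\in\{0,\ldots,M\}$ for $1\le j\le L-1$, and $|i_{j+1}-i_j|=1$ for all $j$. $\kappa(\mathsf{p})=(k_0,\ldots,k_M)$: $k_n$ is the number of maximal blocks of consecutive indices $j\in\{0,\ldots,L\}$ with $i_j\ge n$. Weight: for $1\le j\le L-1$ with $i_j=m$, $w_j=R_m$ if $i_{j-1}=i_{j+1}=m-1$; $w_j=-R_m$ if $i_{j-1}=i_{j+1}=m+1$; $w_j=\sqrt{1-R_m^2}$ otherwise; $w(\mathsf{p})=\prod_{j=1}^{L-1}w_j$. $\mathfrak{L}_M\subset\mathbb{Z}^{M+1}_{\geq0}$: all $k$ with $k_0=1$ and $k_n>0\Rightarrow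 k_{n-1}>0$ ($1\le n\le M$). $\tilde k=(k_1,\ldots,k_M,0)$; $\mathbb{1}=(1,\ldots,1)$; inequalities and $\min$ entrywise; $S^d=\prod_n S_n^{d_n}$; $\binom{k}{b}=\prod_n\binom{k_n}{b_n}$. The amplitude polynomial is $a(x,k)=\sum_{b\in V(k)}\binom{k}{b}\binom{\tilde k-u}{b-u}(-x)^{\tilde k-b}x^{k-b}\prod_n(1-x_n^2)^{b_n}$. *)

(* Defs.v *)
(* Reals are modelled by an arbitrary real closed field F
   (rcfType), which is needed for the square root T_n = sqrt(1 - R_n^2). *)
From HB Require Import structures.
From mathcomp Require Import all_boot all_order all_algebra.
Set Implicit Arguments. Unset Strict Implicit. Unset Printing Implicit Defensive.
Import Order.TTheory GRing.Theory Num.Theory.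
Local Open Scope ring_scope.

Definition scattering_seq (M : nat) (p : seq int) : Prop :=
  let L := (size p).-1 in
  [/\ (2 <= L)%N,
      nth 0 p 0 = -1,
      nth 0 p L = -1,
      (forall j, (1 <= j)%N -> (j <= L - 1)%N ->
          0 <= nth 0 p j /\ nth 0 p j <= M%:Z) &
      (forall j, (j < L)%N -> `|nth 0 p j.+1 - nth 0 p j| = 1)].

(* kappa(p)_n = number of maximal blocks of consecutive indices j in {0..L}
   with i_j >= n; counted by their starting index j (i_j >= n and either
   j = 0 or i_{j-1} < n). *)
Definition kappa (M : nat) (p : seq int) : {ffun 'I_M.+1 -> nat} :=
  [ffun n : 'I_M.+1 =>
     count (fun j => (n%:Z <= nth 0 p j) &&
                     ((j == 0)%N || (nth 0 p j.-1 < n%:Z)))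
           (iota 0 (size p))].

Definition Tcoef (F : rcfType) (M : nat) (R : 'I_M.+1 -> F) (n : 'I_M.+1) : F :=
  Num.sqrt (1 - R n ^+ 2).

Definition wj (F : rcfType) (M : nat) (R : 'I_M.+1 -> F) (p : seq int) (j : nat) : F :=
  let m := nth 0 p j in
  let mi : 'I_M.+1 := inord `|m|%N in
  if (nth 0 p j.-1 == m - 1) && (nth 0 p j.+1 == m - 1) then R mi
  else if (nth 0 p j.-1 == m + 1) && (nth 0 p j.+1 == m + 1) then - R mi
  else Tcoef R mi.

Definition weight (F : rcfType) (M : nat) (R : 'I_M.+1 -> F) (p : seq int) : F :=
  \prod_(1 <= j < (size p).-1) wj R p j.

Definition frakL (M : nat) (k : {ffun 'I_M.+1 -> nat}) : Prop :=
  k ord0 = 1%N /\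
  (forall n : 'I_M.+1, (1 <= n)%N -> (0 < k n)%N -> (0 < k (inord n.-1))%N).

Definition ktilde (M : nat) (k : {ffun 'I_M.+1 -> nat}) (n : 'I_M.+1) : nat :=
  if (n < M)%N then k (inord n.+1) else 0%N.

Definition uvec (M : nat) (k : {ffun 'I_M.+1 -> nat}) (n : 'I_M.+1) : nat :=
  minn 1 (ktilde k n).

(* A strict upper bound for all entries of k; used only as an enclosing
   finite range for b (every b in V(k) satisfies b_n <= k_n < kbound k). *)
Definition kbound (M : nat) (k : {ffun 'I_M.+1 -> nat}) : nat :=
  (\max_(n : 'I_M.+1) k n).+1.

Definition inV (M : nat) (k : {ffun 'I_M.+1 -> nat})
    (b : {ffun 'I_M.+1 -> 'I_(kbound k)}) : bool :=
  [forall n : 'I_M.+1,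
     (uvec k n <= b n)%N && (b n <= minn (k n) (ktilde k n))%N].

Definition rhs_term (F : rcfType) (M : nat) (R : 'I_M.+1 -> F)
    (k : {ffun 'I_M.+1 -> nat}) (b : {ffun 'I_M.+1 -> 'I_(kbound k)}) : F :=
  \prod_(n : 'I_M.+1)
     ('C(k n, b n)%:R * 'C(ktilde k n - uvec k n, b n - uvec k n)%:R
      * (- R n) ^+ (ktilde k n - b n) * (R n) ^+ (k n - b n)
      * (Tcoef R n) ^+ (2 * b n)).

Definition ampl (F : rcfType) (M : nat) (x : 'I_M.+1 -> F)
    (k : {ffun 'I_M.+1 -> nat}) : F :=
  \sum_(b : {ffun 'I_M.+1 -> 'I_(kbound k)} | inV b)
   \prod_(n : 'I_M.+1)
     ('C(k n, b n)%:R * 'C(ktilde k n - uvec k n, b n - uvec k n)%:R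
      * (- x n) ^+ (ktilde k n - b n) * (x n) ^+ (k n - b n)
      * (1 - x n ^+ 2) ^+ (b n)).

(* Main.v *)
Require Import Defs.
From HB Require Import structures.
From mathcomp Require Import all_boot all_order all_algebra.
From mathcomp Require Import ring lra zify.
Import Order.TTheory GRing.Theory Num.Theory.
Local Open Scope ring_scope.

(* A scattering sequence is read step by step. Suppose that the walk is at
   height m and that rem n upward steps from n-1 to n are still to come for
   each n. The total weight of all completions factors over the levels: every
   level n > m contributes the total weight of rem n complete visits with
   rem (n+1) upward exits (closed_factor), every level n < m that of rem n
   complete visits plus one visit which is currently above n (open_factor), and
   level m one or the other according to whether the walk is about to return
   from above or has just arrived from below. Splitting on the next step, up or
   down, changes the factors of two neighbouring levels only, and the resulting
   recurrences are instances of Pascal's rule. *)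

(** * Level factors and their Pascal recurrences *)

Section LevelFactors.

Context {K : comNzRingType} (r t : K).

(* [c.+1] is the number of visits that exit upwards at least once; the [b]
   exits are distributed among these in ['C(b.-1, c)] ways. *)
Definition closed_factor (a b : nat) : K :=
  if b is b'.+1 then
    \sum_(c < a) ('C(a, c.+1) * 'C(b', c))%:R
      * (- r) ^+ (b' - c) * r ^+ (a - c.+1) * t ^+ (2 * c.+1)
  else r ^+ a.

(* Here the open visit may receive none of the [b] exits still to come, so the
   number of distributions is ['C(b, c)] when [c] of the [a] other visits exit
   upwards; the leading [t] pays for the open visit's final step down. *)
Definition open_factor (a b : nat) : K :=
  t * \sum_(c < a.+1) ('C(a, c) * 'C(b, c))%:R
      * (- r) ^+ (b - c) * r ^+ (a - c) * t ^+ (2 * c).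

Lemma closed_factor0 (b : nat) : closed_factor 0 b = (b == 0%N)%:R.
Proof. by case: b => [|b] /=; rewrite ?expr0 // big_ord0. Qed.

Lemma closed_factorS0 (a : nat) : closed_factor a.+1 0 = r * closed_factor a 0.
Proof. by rewrite /= exprS. Qed.

(** Pascal's rule in [a]: the next visit either turns back down at once, with weight [r], or passes
    upwards, with weight [t], using one exit and becoming the open visit. *)
Lemma closed_factorSS (a b : nat) :
  closed_factor a.+1 b.+1 = r * closed_factor a b.+1 + t * open_factor a b.
Proof.
rewrite /closed_factor /open_factor.
under eq_bigr => c _ do rewrite binS mulnDl natrD !mulrDl.
rewrite big_split /=; congr (_ + _).
  rewrite big_ord_recr /= bin_small // mul0n !mul0r addr0 mulr_sumr.
  apply: eq_bigr => c _.
  by rewrite subSn // exprS; ring.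
rewrite !mulr_sumr; apply: eq_bigr => c _.
by rewrite subSS mulnS exprD; ring.
Qed.

Lemma open_factor0 (a : nat) : open_factor a 0 = t * closed_factor a 0.
Proof.
rewrite /open_factor big_ord_recl big1 => [|c _]; last first.
  by rewrite bin0n muln0 !mul0r.
by rewrite /= !bin0 !subn0 /= !muln0 !expr0 addr0 !mul1r mulr1.
Qed.

(** Pascal's rule in [b]: on its return from above, the open visit is either reflected upwards, with
    weight [- r] and one exit used, or leaves downwards with weight [t], so that all exits fall to
    the [a] other visits. *)
Lemma open_factorS (a b : nat) :
  open_factor a b.+1 = - r * open_factor a b + t * closed_factor a b.+1.
Proof.
rewrite /open_factor /closed_factor [- r * _]mulrCA -mulrDr; congr (_ * _).
rewrite 2!big_ord_recl !bin0 !subn0 mulrDr -addrA; congr (_ + _).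
  by rewrite exprS; ring.
rewrite mulr_sumr -big_split /=; apply: eq_bigr => c _.
rewrite /bump /= add1n binS mulnDr natrD subSS.
have [lt_cb|le_bc] := ltnP c b; last by rewrite (@bin_small b c.+1) //; ring.
by rewrite -[(b - c)%N]subSS subSn // exprS; ring.
Qed.

End LevelFactors.

(** * Scattering sequences as walks *)

Fixpoint walk (M : nat) (m : int) (t : seq int) : bool :=
  if t is x :: t' then [&& 0 <= m <= M%:Z, `|x - m| == 1 & walk M x t']
  else m == -1.

(* Every block of heights [>= n] starts with an upward crossing of [n], so this
   computes the entries of [kappa]. *)
Fixpoint ups (n m : int) (t : seq int) : nat :=
  if t is x :: t' then ((m < n <= x)%R + ups n x t')%N else 0%N.

Lemma walk_cons (M : nat) (m x : int) (t : seq int) :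
  walk M m (x :: t) = [&& 0 <= m <= M%:Z, `|x - m| == 1 & walk M x t].
Proof. by []. Qed.

Lemma ups_cons (n m x : int) (t : seq int) :
  ups n m (x :: t) = ((m < n <= x)%R + ups n x t)%N.
Proof. by []. Qed.

Section Weights.

Context {F : rcfType} {M : nat} (R : 'I_M.+1 -> F).

Definition step_weight (a m c : int) : F :=
  let mi : 'I_M.+1 := inord `|m|%N in
  if (a == m - 1) && (c == m - 1) then R mi
  else if (a == m + 1) && (c == m + 1) then - R mi
  else Tcoef R mi.

(** The height before [m] is [a]; the final vertex carries no weight. *)
Fixpoint walk_weight (a m : int) (t : seq int) : F :=
  if t is x :: t' then step_weight a m x * walk_weight m x t' else 1.

Lemma weightE (a m : int) (t : seq int) :
  weight R [:: a, m & t] = walk_weight a m t.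
Proof.
rewrite /weight /= big_add1 /=.
elim: t a m => [|x t IHt] a m; first by rewrite big_nil.
by rewrite /= big_nat_recl // -IHt.
Qed.

End Weights.

Lemma upsE (n m : int) (t : seq int) :
  count (fun j => (n <= nth 0 (m :: t) j) && (nth 0 (m :: t) j.-1 < n))
    (iota 1 (size t)) = ups n m t.
Proof.
elim: t m => [//|x t IHt] m /=.
rewrite -IHt [X in (X + _)%N = _]/= andbC; congr (_ + _)%N.
rewrite (iotaDl 1 1) count_map; apply: eq_in_count => j.
by rewrite mem_iota; case: j.
Qed.

Lemma kappaE (M : nat) (t : seq int) (n : 'I_M.+1) :
  kappa M (-1 :: t) n = ups n%:Z (-1) t.
Proof.
rewrite ffunE /= -upsE.
by apply: eq_in_count => j; rewrite mem_iota; case: j.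
Qed.

Lemma walkP (M : nat) (m : int) (t : seq int) :
  walk M m t <->
  [/\ nth 0 (m :: t) (size t) = -1,
      (forall j, (j < size t)%N -> 0 <= nth 0 (m :: t) j <= M%:Z) &
      (forall j, (j < size t)%N ->
         `|nth 0 (m :: t) j.+1 - nth 0 (m :: t) j| = 1)].
Proof.
elim: t m => [|x t IHt] m /=.
  by split=> [/eqP //|[->]].
split.
  case/and3P=> hm /eqP hx /IHt [h1 h2 h3]; split=> // -[|j] //; [exact: h2|exact: h3].
case=> h1 h2 h3; rewrite (h2 0%N) //= (h3 0%N) //=; apply/IHt.
by split=> // j hj; [apply: (h2 j.+1)|apply: (h3 j.+1)].
Qed.

(** As [L >= 2], index 1 is interior, which forces the first step to go from -1 to 0. *)
Lemma scattering_seqP (M : nat) (p : seq int) :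
  scattering_seq M p <-> exists2 t, p = [:: -1, 0 & t] & walk M 0 t.
Proof.
split.
  case: p => [|i0 [|i1 t]] [] //= h2 -> hL hb hs.
  have h10 : i1 = 0.
    have := hs 0%N erefl; have := hb 1%N erefl; rewrite /=.
    case: t h2 {hL hb hs} => // x t _ /=; rewrite subn1 /= => /(_ erefl); lia.
  rewrite {}h10 in hL hb hs *; exists t => //; apply/walkP; split=> // j hj.
    by have [] := hb j.+1 erefl; [rewrite subn1|move=> /= -> ->].
  exact: (hs j.+1).
case=> t -> ht; have [h1 h2 h3] := (walkP _ _ _).1 ht.
split=> //=.
- by case: t ht {h1 h2 h3}.
- case=> // j _; rewrite subn1 => hj; by have /andP[] := h2 j hj.
- by case=> // j hj; apply: h3.
Qed.

(** * Total weight of the completions of a walk *)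

Section WalkSum.

Context {F : rcfType} {M : nat} (R : 'I_M.+1 -> F).

Let T := Tcoef R.

Definition closed_levels (s : nat) (rem : nat -> nat) : F :=
  \prod_(s <= n < M.+1)
    closed_factor (R (inord n)) (T (inord n)) (rem n) (rem n.+1).

Definition open_levels (s : nat) (rem : nat -> nat) : F :=
  \prod_(0 <= n < s)
    open_factor (R (inord n)) (T (inord n)) (rem n) (rem n.+1).

(** If [i.+1] is the least index with a nonzero entry, level [i] has exits but no visits left, so
    its factor vanishes. *)
Lemma closed_levels_eq0 (rem : nat -> nat) :
  rem 0%N = 0%N -> rem M.+1 = 0%N ->
  closed_levels 0 rem = (all (fun n => rem n == 0%N) (iota 0 M.+1))%:R.
Proof.
move=> rem0 remM; rewrite /closed_levels.
have [/allP rem_eq0|/allPn[n]] := boolP (all _ _).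
  rewrite big_nat big1 // => n /andP[_ ltnM].
  have rem_n0 : rem n = 0%N by apply/eqP/rem_eq0; rewrite mem_iota.
  have rem_n10 : rem n.+1 = 0%N.
    have [->|ltnM'] := eqVneq n M; first exact: remM.
    by apply/eqP/rem_eq0; rewrite mem_iota /= add0n; lia.
  by rewrite rem_n0 rem_n10 closed_factor0.
rewrite mem_iota /= add0n => ltnM rem_n.
have ex_n : exists n, rem n != 0%N by exists n.
case: (ex_minnP ex_n) => -[|i] rem_i min_i; first by rewrite rem0 in rem_i.
have lt_in : (i.+1 <= n)%N by apply: min_i.
have rem_i0 : rem i = 0%N.
  by apply/eqP; apply: contraT => /min_i; rewrite ltnn.
rewrite (bigD1_seq i) ?iota_uniq //=; last by rewrite mem_index_iota; lia.
by rewrite rem_i0 closed_factor0 (negPf rem_i) mul0r.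
Qed.

(** At height -1 the walk has ended: only the empty completion is possible, and only if no upward
    step remains. *)
Lemma walk_sum_ground (rem : nat -> nat) :
  rem 0%N = 0%N -> rem M.+1 = 0%N ->
  exists l : seq (seq int),
    [/\ uniq l,
        (forall t, t \in l <-> walk M (0%:Z - 1) t /\
           forall n : nat, (n <= M)%N -> ups n%:Z (0%:Z - 1) t = rem n)
      & \sum_(t <- l) walk_weight R 0%:Z (0%:Z - 1) t
          = open_levels 0 rem * closed_levels 0 rem].
Proof.
move=> rem0 remM; rewrite /open_levels big_geq // mul1r closed_levels_eq0 //.
set z := all _ _; exists (if z then [:: [::]] else [::]).
have zP : z <-> forall n, (n <= M)%N -> 0%N = rem n.
  split=> [/allP h n leM|h]; first by apply/esym/eqP/h; rewrite mem_iota.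
  by apply/allP => n; rewrite mem_iota add0n ltnS => /h <-.
split; first by case: z {zP}.
  move=> t; split=> [|[]].
    by case: z zP => // zP; rewrite inE => /eqP ->; split=> //; apply/zP.
  by case: t => //= _ /zP ->.
by case: z {zP}; rewrite ?big_nil ?big_seq1.
Qed.

(* [s = m + 1] is the current height shifted by one; [N] bounds the number of
   remaining steps. The two sums differ in the direction of the step just taken,
   which enters only through the weight of the current vertex. *)
Lemma walk_sum (N s : nat) (rem : nat -> nat) :
  (s <= M.+1)%N -> rem 0%N = 0%N -> rem M.+1 = 0%N ->
  (s + 2 * \sum_(n < M.+1) rem n <= N)%N ->
  exists l : seq (seq int),
    [/\ uniq l,
        (forall t, t \in l <-> walk M (s%:Z - 1) t /\
           forall n : nat, (n <= M)%N -> ups n%:Z (s%:Z - 1) t = rem n),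
        \sum_(t <- l) walk_weight R s%:Z (s%:Z - 1) t
          = open_levels s rem * closed_levels s rem
      & (0 < s)%N -> \sum_(t <- l) walk_weight R (s%:Z - 2) (s%:Z - 1) t
          = open_levels s.-1 rem
            * closed_factor (R (inord s.-1)) (T (inord s.-1))
                (rem s.-1).+1 (rem s)
            * closed_levels s rem].
Proof.
elim: N s rem => [|N IHN] [|m] rem // les rem0 remM hN.
1,2: by have [l [? ? ?]] := walk_sum_ground rem rem0 remM; exists l.
have [||||l1 [ul1 ml1 sd1 _]] := IHN m rem => //; first by lia.
have -> : m.+1%:Z - 1 = m%:Z by lia.
have -> : m.+1%:Z - 2 = m%:Z - 1 by lia.
set dn := (m%:Z - 1) in ml1 sd1 *.
pose up : int := m.+1%:Z.
have updn : up != dn by rewrite /up /dn; lia.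
have consD l : uniq l -> uniq [seq dn :: t | t <- l].
  by move=> ul; rewrite map_inj_uniq // => ? ? [].
have stepD a : step_weight R a m dn = if a == dn then R (inord m) else T (inord m).
  rewrite /step_weight eqxx andbT absz_nat.
  by case: eqP => // _; rewrite [dn == _](_ : _ = false) ?andbF // /dn; lia.
have stepU a : step_weight R a m up = if a == up then - R (inord m) else T (inord m).
  rewrite /step_weight absz_nat.
  have [-> ->] : (up == m%:Z - 1) = false /\ m%:Z + 1 = up by rewrite /up; lia.
  by rewrite eqxx andbF andbT.
have m_in : 0 <= m%:Z <= M%:Z by lia.
have walkD t : walk M m (dn :: t) = walk M dn t.
  by rewrite walk_cons m_in (_ : `|dn - m%:Z| == 1) // /dn; lia.
have upsD (n : nat) t : ups n m (dn :: t) = ups n dn t 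
  by rewrite ups_cons (_ : (m%:Z < n%:Z <= dn) = false) // /dn; lia.
have upsU (n : nat) t : ups n m (up :: t) = ((n == m.+1) + ups n up t)%N.
  by rewrite ups_cons; congr (nat_of_bool _ + _)%N; rewrite /up; lia.
have walkU t : walk M m (up :: t) = walk M up t.
  by rewrite walk_cons m_in (_ : `|up - m%:Z| == 1) // /up; lia.
have walk_up t : walk M up t -> (m < M)%N.
  by case: t => [|x t] /=; rewrite /up; lia.
have walkE t : walk M m t ->
    exists t', t = dn :: t' \/ t = up :: t'.
  case: t => [|x t] h; first by move: h => /=; lia.
  exists t; move: h => /= /and3P[_ hx _].
  have [->|->] : x = dn \/ x = up by rewrite /dn /up; lia.
    by left.
  by right.
have mem_dn t : t \in l1 <-> walk M m (dn :: t) /\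
    forall n : nat, (n <= M)%N -> ups n m (dn :: t) = rem n.
  rewrite ml1 walkD; split=> -[h1 h2]; split=> // n /h2; by rewrite upsD.
have sumD a : \sum_(t <- [seq dn :: t | t <- l1]) walk_weight R a m t =
    step_weight R a m dn * (open_levels m rem * closed_levels m rem).
  by rewrite big_map -mulr_sumr -sd1.
have closedE : closed_levels m rem =
    closed_factor (R (inord m)) (T (inord m)) (rem m) (rem m.+1)
    * closed_levels m.+1 rem.
  by rewrite /closed_levels big_ltn.
have openE r : open_levels m.+1 r = open_levels m r *
    open_factor (R (inord m)) (T (inord m)) (r m) (r m.+1).
  by rewrite /open_levels big_nat_recr.
have updn1 : up == dn = false by apply/negbTE.
(* With no upward step to [m.+1] left, the walk must go down. *)
case Erem : (rem m.+1) => [|q].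
  exists [seq dn :: t | t <- l1]; split=> //.
  - exact: consD.
  - move=> t; split=> [/mapP[t' /mem_dn ? ->]//|[]].
    move=> /[dup] /walkE[t' [->|->]].
      by move=> h1 h2; apply/map_f/mem_dn.
    move=> + h; rewrite walkU => /walk_up ltmM.
    by have := h m.+1 ltmM; rewrite upsU eqxx Erem.
  - by rewrite sumD stepD -/up updn1 openE closedE Erem open_factor0; ring.
  - by move=> _; rewrite sumD stepD eqxx closedE -[m.+1.-1]/m Erem closed_factorS0; ring.
have neqM : m != M by apply/eqP => eqM; rewrite eqM remM in Erem.
pose rem' n := (rem n - (n == m.+1))%N.
have rem'E n : rem n = ((n == m.+1) + rem' n)%N.
  by rewrite /rem'; have [->|_] := eqVneq n m.+1; rewrite ?Erem ?subn1 ?subn0.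
(* A step up raises the height by one but lowers twice this sum by two, so the bound on the
   remaining steps drops by one. *)
have sum_rem : \sum_(n < M.+1) rem n = (\sum_(n < M.+1) rem' n).+1.
  have ltm1M : (m.+1 < M.+1)%N by lia.
  under eq_bigr => n _ do rewrite rem'E.
  rewrite big_split /= -[RHS]add1n; congr addn.
  rewrite (bigD1 (Ordinal ltm1M)) //= eqxx big1 ?addn0 // => n neq_n.
  by rewrite -val_eqE /= in neq_n; rewrite (negPf neq_n).
(* Here the walk arrives from below, so the second sum applies; the visit just begun restores the
   count [rem m.+1] in [(rem' m.+1).+1]. *)
have [||||l2 [ul2 ml2 _ /(_ isT)]] := IHN m.+2 rem'; first by lia.
- by rewrite /rem' rem0.
- by rewrite /rem' remM.
- by move: hN; rewrite sum_rem; lia.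
have <- : m%:Z = m.+2%:Z - 2 by lia.
have upE : up = m.+2%:Z - 1 by rewrite /up; lia.
rewrite -upE -[m.+2.-1]/m.+1 in ml2 * => su2.
have rem'm : rem' m.+1 = q by rewrite /rem' Erem eqxx subn1.
have rem'_neq n : n != m.+1 -> rem' n = rem n.
  by rewrite /rem' => /negPf ->; rewrite subn0.
have sumU a : \sum_(t <- [seq up :: t | t <- l2]) walk_weight R a m t =
    step_weight R a m up *
    (open_levels m rem * open_factor (R (inord m)) (T (inord m)) (rem m) q
     * closed_levels m.+1 rem).
  rewrite big_map -mulr_sumr su2 rem'm -Erem openE rem'm rem'_neq; last by lia.
  rewrite [in RHS]/closed_levels big_ltn; last by lia.
  rewrite -/(closed_levels _ _) (rem'_neq m.+2); last by lia.
  have -> : open_levels m rem' = open_levels m rem.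
    apply: eq_big_nat => n /andP[_ ltnm].
    by rewrite !rem'_neq //; lia.
  have -> : closed_levels m.+2 rem' = closed_levels m.+2 rem.
    by apply: eq_big_nat => n /andP[ltmn _]; rewrite !rem'_neq //; lia.
  by ring.
exists ([seq dn :: t | t <- l1] ++ [seq up :: t | t <- l2]); split=> //.
- rewrite cat_uniq consD // map_inj_uniq => [|? ? []//]; rewrite ul2 andbT /=.
  apply/hasPn => _ /mapP[t _ ->]; apply/mapP => -[t' _ [eq_ud]].
  by rewrite eq_ud eqxx in updn.
- have mem_up t : t \in l2 <-> walk M m (up :: t) /\
      forall n : nat, (n <= M)%N -> ups n m (up :: t) = rem n.
    rewrite ml2 walkU; split=> -[h1 h2]; split=> // n /[dup] leM /h2.
      by rewrite upsU rem'E => ->.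
    by rewrite upsU rem'E => /addnI.
  move=> t; rewrite mem_cat; split.
    by case/orP=> /mapP[t' + ->] => [/mem_dn|/mem_up].
  case=> /[dup] /walkE[t' [->|->]] h1 h2; apply/orP; [left|right].
    by apply/map_f/mem_dn.
  by apply/map_f/mem_up.
- rewrite big_cat [LHS]/= sumD sumU stepD stepU -/up updn1 eqxx closedE openE Erem.
  by rewrite open_factorS; ring.
- move=> _; rewrite big_cat [LHS]/= sumD sumU stepD stepU eqxx.
  by rewrite [dn == up]eq_sym updn1 closedE Erem closed_factorSS; ring.
Qed.

End WalkSum.

(** * From level factors to the amplitude polynomial *)

(* The lower bound [u <= b] discards exactly the [c = 0] term, whose binomial
   ['C(b - u, c - u)] is [1] because of truncated subtraction. *)
Lemma closed_factorE (K : comNzRingType) (r t : K) (a b N : nat) :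
  (a < N)%N ->
  closed_factor r t a b =
  \sum_(c < N | (minn 1 b <= c)%N && (c <= minn a b)%N)
    ('C(a, c)%:R * 'C(b - minn 1 b, c - minn 1 b)%:R
      * (- r) ^+ (b - c) * r ^+ (a - c) * t ^+ (2 * c)).
Proof.
case: N => // N; rewrite ltnS => leaN.
rewrite big_mkcond big_ord_recl /=; case: b => [|b].
  rewrite !minn0 leqnn big1 => [|c _]; last by rewrite /bump.
  by rewrite /= !bin0 !subn0 !muln0 !expr0 addr0 !mul1r mulr1.
rewrite [minn 1 _](_ : _ = 1%N) /=; last by lia.
rewrite add0r (big_ord_widen _ (fun c : nat =>
  ('C(a, c.+1) * 'C(b, c))%:R * (- r) ^+ (b - c) * r ^+ (a - c.+1)
    * t ^+ (2 * c.+1)) leaN) big_mkcond /=.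
apply: eq_bigr => c _; rewrite /bump /= add1n !subn1 /= subSS leq_min ltnS.
rewrite natrM; case: ltnP => // ltca; case: leqP => // ltbc.
by rewrite (bin_small ltbc) mulr0 !mul0r.
Qed.

Theorem theorem6p3 (F : rcfType) (M : nat) (R : 'I_M.+1 -> F)
    (k : {ffun 'I_M.+1 -> nat}) :
  (1 <= M)%N ->
  (forall n, -1 < R n < 1) ->
  frakL k ->
  exists s : seq (seq int),
    [/\ uniq s,
        (forall p, p \in s <-> (scattering_seq M p /\ kappa M p = k)),
        \sum_(p <- s) weight R p =
          \sum_(b : {ffun 'I_M.+1 -> 'I_(kbound k)} | inV b) rhs_term R b
      & \sum_(p <- s) weight R p = ampl R k].
Proof.
move=> _ R_lt1 [k0 _].
have rhs_ampl : \sum_(b : {ffun 'I_M.+1 -> 'I_(kbound k)} | inV b) rhs_term R b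
    = ampl R k.
  apply: eq_bigr => b _; apply: eq_bigr => n _; congr (_ * _).
  rewrite exprM /Tcoef sqr_sqrtr //; have := R_lt1 n; nra.
rewrite -rhs_ampl.
(* Padding with zero beyond [M] makes [ktilde] a plain shift. *)
pose kn n := if (n <= M)%N then k (inord n) else 0%N.
have knE (n : 'I_M.+1) : kn n = k n by rewrite /kn -ltnS ltn_ord inord_val.
have kn0 : kn 0%N = 1%N by rewrite -k0 -(knE ord0).
have ktildeE (n : 'I_M.+1) : ktilde k n = kn n.+1 by [].
(* The forced first step uses up the only upward crossing into level 0; the visit it begins is the
   extra one in [(rem 0).+1]. *)
pose rem n := if n == 0%N then 0%N else kn n.
have [|||l [ul ml _ /(_ isT) sl]] := @walk_sum F M R _ 1 rem _ _ _ (leqnn _) => //.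
  by rewrite /rem /kn ltnn.
have upsE n t : ups n%:Z (-1) (0 :: t) = ((n == 0%N) + ups n%:Z 0 t)%N.
  by rewrite ups_cons; congr (nat_of_bool _ + _)%N; lia.
have kn_rem n : kn n = ((n == 0%N) + rem n)%N by rewrite /rem; case: eqP => [->|].
exists [seq [:: -1, 0 & t] | t <- l].
have sumE : \sum_(p <- [seq [:: -1, 0 & t] | t <- l]) weight R p =
    \sum_(b : {ffun 'I_M.+1 -> 'I_(kbound k)} | inV b) rhs_term R b.
  rewrite big_map; under eq_bigr => t _ do rewrite weightE.
  rewrite {}sl /open_levels big_geq // mul1r.
  transitivity (\prod_(n < M.+1) closed_factor (R n) (Tcoef R n) (k n) (ktilde k n)).
    transitivity (\prod_(0 <= n < M.+1) closed_factor (R (inord n))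
        (Tcoef R (inord n)) (kn n) (kn n.+1)).
      rewrite [RHS]big_ltn // kn0; congr (_ * _).
      by apply: eq_big_nat => -[].
    rewrite big_mkord; apply: eq_bigr => n _.
    by rewrite inord_val knE ktildeE.
  rewrite /inV /rhs_term.
  under eq_bigr => n _.
    rewrite (@closed_factorE _ _ _ _ _ (kbound k)); last first.
      by rewrite ltnS; exact: leq_bigmax.
    over.
  (* Distributivity turns the product over levels of sums over [c] into a sum over vectors [b]. *)
  rewrite bigA_distr_big_dep.
  apply: eq_bigl => b; apply/familyP/forallP => h n; exact: h.
split=> //.
  by rewrite map_inj_uniq // => ? ? [].
move=> p; split.
  case/mapP=> t /ml[h1 h2] ->; split; first by apply/scattering_seqP; exists t.
  by apply/ffunP => n; rewrite kappaE upsE -knE kn_rem h2 // -ltnS.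
case=> /scattering_seqP[t -> ht] kp; apply/map_f/ml; split=> // n leM.
apply/(@addnI (n == 0%N)); rewrite -kn_rem -upsE.
by rewrite -[n]/(nat_of_ord (Ordinal (leM : (n < M.+1)%N))) -kappaE kp knE.
Qed.
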